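(* Let $\pi_x:\mathbb R^d\to[0,1]$ be a possibility contour that is continuous and unimodal, attaining its unique maximum at $\hat\theta_x$, and suppose $\pi_x(\vartheta)\to0$ as $\|\vartheta\|\to\infty$, so that the cuts $A_\alpha(x)=\{\vartheta:\pi_x(\vartheta)\ge\alpha\}$ ($\alpha\in(0,1]$) are compact. Let $\Gamma_\theta(\vartheta)=g(\|\vartheta-\theta\|)$, where $g:[0,\infty)\to[0,\infty)$ is continuous and strictly increasing, and assume $L(\theta,\Pi_x)<\infty$. Then: (a) The maximizer set $M_{\alpha,\theta}(x):=\arg\max_{\vartheta\in A_\alpha(x)}\Gamma_\theta(\vartheta)$ is nonempty and satisfies $M_{\alpha,\theta}(x)\subseteq\{\vartheta:\pi_x(\vartheta)=\alpha\}$ for every $\alpha\in(0,1)$. (b) There exists a (generally $\theta$-dependent) saturating inner probability $Q^\ast_{x,\theta}\in\mathcal C^\ast(\Pi_x)$ such that $E_{Q^\ast_{x,\theta}}\{\Gamma_\theta(\vartheta)\}=L(\theta,\Pi_x)$. (c) Consequently, $$\sup_{Q\in\mathcal C(\Pi_x)}E_Q\{\Gamma_\theta(\vartheta)\}=\sup_{Q\in\mathcal C^\ast(\Pi_x)}E_Q\{\Gamma_\theta(\vartheta)\}=L(\theta,\Pi_x).$$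
   Context: Here $\Theta=\mathbb R^d$ and $x$ and $\theta\in\mathbb R^d$ are fixed; $\|\cdot\|$ is the Euclidean norm. A possibility contour is a function $\pi_x:\Theta\to[0,1]$ with $\sup\pi_x=1$; the associated possibility measure is $\Pi_x(B)=\sup_{\vartheta\in B}\pi_x(\vartheta)$ for Borel $B$. ''Unimodal'' is used here for having a unique global maximizer $\hat\theta_x$. The credal set is $$\mathcal C(\Pi_x)=\{Q\text{ a Borel probability measure on }\Theta:\ Q(B)\le\Pi_x(B)\ \text{for all Borel }B\},$$ and the class of saturating inner probabilities is $$\mathcal C^\ast(\Pi_x)=\{Q\in\mathcal C(\Pi_x):\ Q(A_\alpha(x))=1-\alpha\ \ \forall\alpha\in[0,1]\}.$$ The Choquet loss is $$L(\theta,\Pi_x)=\int_0^1\sup_{\vartheta\in A_\alpha(x)}\Gamma_\theta(\vartheta)\,d\alpha.$$ $E_Q\{\Gamma_\theta(\vartheta)\}$ denotes $\int\Gamma_\theta(\vartheta)\,Q(d\vartheta)$. *)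

(* Defs.v *)
From HB Require Import structures.
From mathcomp Require Import all_boot all_order all_algebra.
From mathcomp Require Import all_classical all_reals all_analysis.

Set Implicit Arguments.
Unset Strict Implicit.
Unset Printing Implicit Defensive.

Import Order.TTheory GRing.Theory Num.Theory.
Import numFieldNormedType.Exports.

Local Open Scope classical_set_scope.
Local Open Scope ring_scope.

(* R^d with its Borel sigma-algebra; the product topology on row vectors is
   the Euclidean one. *)
Notation borelRd R d := (g_sigma_algebraType (@open 'rV[R]_d)).

(* The library norm `|v| on row vectors is the sup norm, hence this one. *)
Definition enorm (R : realType) (d : nat) (v : 'rV[R]_d) : R :=
  Num.sqrt (\sum_(i < d) v ord0 i ^+ 2).

Definition argmax (T : Type) (R : realType) (f : T -> R) (A : set T) : set T :=
  [set v | A v /\ forall w, A w -> f w <= f v].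

Definition is_contour (T : Type) (R : realType) (pi_x : T -> R) : Prop :=
  (forall v, 0 <= pi_x v <= 1) /\ sup (range pi_x) = 1.

Definition unimodal_at (T : Type) (R : realType) (pi_x : T -> R) (m : T) : Prop :=
  argmax pi_x setT = [set m].

Definition vanishes_at_infinity (R : realType) (d : nat)
    (f : 'rV[R]_d -> R) : Prop :=
  forall e : R, 0 < e -> exists M : R, forall v, M < enorm v -> `|f v| < e.

Definition upper_cut (T : Type) (R : realType) (pi_x : T -> R) (alpha : R) : set T :=
  [set v | alpha <= pi_x v].

(* As sup set0 = 0 in the library, the empty event has possibility 0. *)
Definition possibility (T : Type) (R : realType) (pi_x : T -> R) (B : set T) : R :=
  sup (pi_x @` B).

Definition credal (R : realType) (d : nat) (pi_x : 'rV[R]_d -> R) :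
    set (probability (borelRd R d) R) :=
  [set Q | forall B : set (borelRd R d), measurable B ->
     (Q B <= (possibility pi_x B)%:E)%E].

Definition saturating (R : realType) (d : nat) (pi_x : 'rV[R]_d -> R) :
    set (probability (borelRd R d) R) :=
  [set Q | credal pi_x Q /\
     forall alpha : R, 0 <= alpha <= 1 -> Q (upper_cut pi_x alpha) = (1 - alpha)%:E].

Definition radial_loss (R : realType) (d : nat) (g : R -> R)
    (theta v : 'rV[R]_d) : R :=
  g (enorm (v - theta)).

Definition choquet_loss (T : Type) (R : realType) (Gamma pi_x : T -> R) : \bar R :=
  (\int[lebesgue_measure]_(alpha in `[0%R, 1%R])
     ereal_sup [set (Gamma v)%:E | v in upper_cut pi_x alpha])%E.

Definition expect (R : realType) (d : nat)
    (Q : probability (borelRd R d) R) (f : 'rV[R]_d -> R) : \bar R :=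
  (\int[Q]_v (f v)%:E)%E.

(* Main.v *)
Require Import Defs.
From HB Require Import structures.
From mathcomp Require Import all_boot all_order all_algebra.
From mathcomp Require Import all_classical all_reals all_analysis.
From mathcomp Require Import measurable_realfun.

Set Implicit Arguments.
Unset Strict Implicit.
Unset Printing Implicit Defensive.

Import Order.TTheory GRing.Theory Num.Theory.
Import numFieldNormedType.Exports.

Local Open Scope classical_set_scope.
Local Open Scope ring_scope.

(** For a level [alpha] in ]0, 1] the cut is compact, so the continuous loss
    attains its maximum there, and it does so on the level set
    [pi_x = alpha]: at a point where [pi_x] exceeds [alpha] one may still move
    away from [theta] inside the cut, which increases the loss
    ([argmax_radial_loss_level]).

    Choose a maximizer [m alpha] at each level, measurably in [alpha], and let
    [Q] be the law of [m alpha] for [alpha] uniform on [0, 1]. Since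
    [pi_x (m alpha) = alpha], the law [Q] saturates the contour, and an event
    [B] can only be hit at levels up to [sup pi_x] over [B], so that [Q] is in
    the credal set. By change of variables the expected loss under [Q] is the
    Choquet loss ([expect_selection_law]).

    Conversely, for [P] in the credal set, [P (Gamma > t)] is at most the
    possibility [s] of that event. At any level [alpha < s] the cut contains a
    point with [Gamma > t], hence [Gamma (m alpha) > t]: the tails of [Gamma]
    are the largest under [Q] ([credal_tail_le]), and by the tail formula so is
    its expectation. Both suprema are therefore attained at [Q].

    The measurable choice rests on one stability property. Consider families of
    non-empty compact sets for which the indices of the members meeting a given
    closed set always form a measurable set. The cuts are such a family, since
    they are nested, and passing to the maximizers of a continuous function
    preserves the property ([measurable_compact_family_argmax]). Maximizing the
    loss and then the coordinates one by one leaves a single point, which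
    depends measurably on the level ([measurable_selection]). *)

(** * Euclidean norm, radial losses and cuts *)

Section EuclideanNorm.
Context {R : realType} {d : nat}.
Implicit Types v w : 'rV[R]_d.

Lemma enorm_ge0 v : 0 <= enorm v.
Proof. exact: sqrtr_ge0. Qed.

Lemma coord_le_enorm v i : `|v ord0 i| <= enorm v.
Proof.
rewrite -sqrtr_sqr; apply: ler_wsqrtr.
by rewrite (bigD1 i)//= lerDl sumr_ge0// => j _; exact: sqr_ge0.
Qed.

Lemma norm_le_enorm v : `|v| <= enorm v.
Proof.
rewrite [`|v|]mx_normrE; apply: bigmax_le; first exact: enorm_ge0.
by move=> [i j] _ /=; rewrite (ord1 i) coord_le_enorm.
Qed.

Lemma enormZ (a : R) v : enorm (a *: v) = `|a| * enorm v.
Proof.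
rewrite /enorm; under eq_bigr do rewrite mxE exprMn.
by rewrite -mulr_sumr sqrtrM ?sqr_ge0// sqrtr_sqr.
Qed.

Lemma enorm0 : enorm (0 : 'rV[R]_d) = 0.
Proof. by have := enormZ 0 0; rewrite scale0r normr0 mul0r. Qed.

Lemma enorm_gt0 v : (0 < enorm v) = (v != 0).
Proof.
apply/idP/idP => [|v0].
  by apply: contraTneq => ->; rewrite enorm0 ltxx.
rewrite lt_neqAle enorm_ge0 andbT; apply: contraNN v0 => /eqP v0.
by rewrite -normr_le0 v0 norm_le_enorm.
Qed.

Lemma continuous_enorm : continuous (@enorm R d).
Proof.
move=> v; apply: (@continuous_comp _ _ _ _ (@Num.sqrt R)); last first.
  exact: sqrt_continuous.
apply: continuous_big; first exact: add_continuous.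
move=> i _ w.
apply: (@continuous_comp _ _ _ (fun u : 'rV[R]_d => u ord0 i)
  (fun x => x ^+ 2)).
  exact: coord_continuous.
exact: exprn_continuous.
Qed.

End EuclideanNorm.

Lemma continuous_radial_loss (R : realType) (d : nat) (g : R -> R)
    (theta : 'rV[R]_d) :
  {within [set r : R | 0 <= r], continuous g} ->
  continuous (radial_loss g theta).
Proof.
move=> gc v; pose A := [set r : R | 0 <= r].
have rc : enorm (w - theta) @[w --> v] --> enorm (v - theta).
  have vt : (w - theta) @[w --> v] --> v - theta.
    exact: (cvgB cvg_id (cvg_cst theta)).
  exact: (continuous_cvg _ (@continuous_enorm R d (v - theta)) vt).
have rA : enorm (w - theta) @[w --> v] --> within A (nbhs (enorm (v - theta))).
  move=> U /rc rU; apply: (@filterS _ (nbhs v) _ _ _ _ rU) => w /=; apply.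
  exact: enorm_ge0.
have gA : g x @[x --> within A (nbhs (enorm (v - theta)))]
    --> g (enorm (v - theta)).
  by rewrite nbhs_subspace_in; [exact: gc|exact: enorm_ge0].
exact: cvg_comp rA gA.
Qed.

Lemma closed_superlevel (X : topologicalType) (R : realType) (f : X -> R)
    (a : R) :
  continuous f -> closed [set v | a <= f v].
Proof.
by move=> /continuous_closedP fc; exact: (fc _ (@closed_ge _ a)).
Qed.

(** A superlevel set of a continuous function vanishing at infinity is compact
    as soon as the level is positive. *)
Lemma upper_cut_compact (R : realType) (d : nat) (f : 'rV[R]_d -> R)
    (alpha : R) :
  continuous f -> vanishes_at_infinity f -> 0 < alpha ->
  compact (upper_cut f alpha).
Proof.
move=> fc f0 alpha0; apply: bounded_closed_compact; last first.
  exact: closed_superlevel.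
have [M fM] := f0 _ alpha0.
exists M; split; first exact: num_real.
move=> x Mx v /= fv; apply: (le_trans (norm_le_enorm v)).
rewrite leNgt; apply/negP => xv.
have := fM v (lt_trans Mx xv); apply/negP; rewrite -leNgt.
exact: le_trans fv (ler_norm _).
Qed.

(** Moving away from [theta] increases a radial loss, so that a point of a cut
    at which the contour exceeds the level is never a maximizer. *)
Lemma argmax_radial_loss_level (R : realType) (d : nat) (f : 'rV[R]_d -> R)
    (g : R -> R) (theta : 'rV[R]_d) (alpha : R) :
  (0 < d)%N -> continuous f ->
  (forall r s : R, 0 <= r -> r < s -> g r < g s) ->
  argmax (radial_loss g theta) (upper_cut f alpha)
    `<=` [set v | f v = alpha].
Proof.
move=> d0 fc gi v [/= afv vmax]; apply/eqP; rewrite eq_le afv andbT leNgt.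
apply/negP => alphav.
(* A direction in which the distance to theta grows; at theta itself any
   non-zero vector will do, and there is one since d > 0. *)
pose w : 'rV[R]_d := if v == theta then const_mx 1 else v - theta.
have wfar (s : R) : 0 < s -> enorm (v - theta) < enorm (v + s *: w - theta).
  move=> s0; rewrite addrAC /w; have [->|vt] := eqVneq v theta.
    rewrite subrr add0r enormZ.
    rewrite enorm0 mulr_gt0 ?normr_gt0 ?gt_eqF// enorm_gt0.
    apply/negP => /eqP/matrixP/(_ ord0 (Ordinal d0)); rewrite !mxE => /eqP.
    by rewrite oner_eq0.
  rewrite -[X in _ < enorm (X + _)]scale1r -scalerDl enormZ ltr_pMl.
    by rewrite gtr0_norm ?addr_gt0// ltrDl.
  by rewrite enorm_gt0 subr_eq0.
have vw : v + s *: w @[s --> (0 : R)] --> v.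
  rewrite -[X in _ --> X]addr0 -[X in _ --> v + X](scale0r w).
  apply: cvgD; first exact: cvg_cst.
  by apply: cvgZr_tmp; exact: cvg_id.
have fw : f (v + s *: w) @[s --> (0 : R)] --> f v.
  exact: (continuous_cvg _ (fc v) vw).
have fgt : \forall s \near (0 : R), alpha < f (v + s *: w).
  exact: cvgr_gt fw _ alphav.
have /nbhs_ballP[e /= e0 be] := fgt.
have e20 : 0 < e / 2 by rewrite divr_gt0.
have /ltW fe : alpha < f (v + (e / 2) *: w).
  apply: be; rewrite /ball /= sub0r normrN gtr0_norm//.
  by rewrite ltr_pdivrMr// ltr_pMr// ltr1n.
have := vmax _ fe; apply/negP; rewrite -ltNge.
by apply: gi; [exact: enorm_ge0|exact: wfar].
Qed.

(** * Measurable selection of maximizers *)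

(** A family [F] of non-empty compact subsets of [X], indexed by a measurable
    space, that is measurable in the sense that the indices of the members
    meeting a given closed set always form a measurable set. *)
Definition measurable_compact_family (disp : measure_display)
    (T : measurableType disp) (X : topologicalType) (F : T -> set X) : Prop :=
  [/\ forall t, F t !=set0,
      forall t, compact (F t) &
      forall K, closed K -> measurable [set t | F t `&` K !=set0]].

Section MaximizersOfFamily.
Context {disp : measure_display} {T : measurableType disp}.
Context {X : topologicalType} {R : realType}.
Implicit Types (F : T -> set X) (f : X -> R) (K : set X).

(* The maximum of [f] over [F t `&` K], equal to -oo when that set is empty. *)
Let maxval F f K t : \bar R := ereal_sup [set (f v)%:E | v in F t `&` K].

Lemma compact_argmax_neq0 f (A : set X) :
  continuous f -> A !=set0 -> compact A -> argmax f A !=set0.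
Proof.
move=> fc A0 Ac; have [|c] := compact_EVT_max A0 Ac (f := f).
  exact: continuous_subspaceT.
by rewrite inE => Ac' cmax; exists c; split=> // w Aw; apply: cmax; rewrite inE.
Qed.

Lemma maxval_attained F f K t : measurable_compact_family F -> continuous f ->
  closed K -> F t `&` K !=set0 ->
  exists v, [/\ F t v, K v & maxval F f K t = (f v)%:E].
Proof.
move=> [_ Fc _] fc Kc FK0.
have FKc := compact_closedI (Fc t) Kc.
have [v [[Fv Kv] vmax]] := compact_argmax_neq0 fc FK0 FKc.
exists v; split=> //; apply/eqP; rewrite eq_le; apply/andP; split.
  by apply: ge_ereal_sup => _ [w FKw <-]; rewrite lee_fin vmax.
by apply: ereal_sup_ubound; exists v.
Qed.

Lemma measurable_maxval F f K : measurable_compact_family F -> continuous f ->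
  closed K -> measurable_fun setT (maxval F f K).
Proof.
move=> mF fc Kc; have [F0 Fc FK] := mF.
apply: (measurability _ (ErealGenCInfty.measurableE R)) => _ [_ [a ->] <-].
have Kac : closed (K `&` [set v | a <= f v]).
  by apply: closedI => //; exact: closed_superlevel.
rewrite setTI (_ : _ @^-1` _ =
    [set t | F t `&` (K `&` [set v | a <= f v]) !=set0]).
  exact: FK.
apply/seteqP; split=> t /=; rewrite in_itv/= andbT.
  move=> at_; have FK0 : F t `&` K !=set0.
    apply/set0P/negP => /eqP FK0; move: at_.
    by rewrite /maxval FK0 image_set0 ereal_sup0 leeNy_eq.
  have [v [Fv Kv vE]] := maxval_attained mF fc Kc FK0.
  by exists v; split=> //; split=> //=; move: at_; rewrite vE lee_fin.
move=> [v [Fv [Kv /= av]]]; apply: (@le_trans _ _ (f v)%:E) => //.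
by apply: ereal_sup_ubound; exists v.
Qed.

(** The maximizers of [f] on [F t] meet [K] exactly when the maximum of [f] over
    [F t `&` K] is as large as the maximum over [F t]; both maxima are
    measurable functions of [t]. *)
Lemma measurable_compact_family_argmax F f :
  hausdorff_space X -> measurable_compact_family F -> continuous f ->
  measurable_compact_family (fun t => argmax f (F t)).
Proof.
move=> hX mF fc; have [F0 Fc FK] := mF.
split=> [t|t|K Kc]; first exact: compact_argmax_neq0.
  have [c [Fct cmax]] := compact_argmax_neq0 fc (F0 t) (Fc t).
  rewrite (_ : argmax _ _ = F t `&` [set v | f c <= f v]).
    by apply: compact_closedI => //; exact: closed_superlevel.
  apply/seteqP; split=> [v [Fv vmax]|v [Fv /= cv]]; split=> //=.
    exact: vmax.
  by move=> w /cmax /le_trans; apply.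
rewrite (_ : [set t | _] =
    setT `&` [set t | (maxval F f setT t <= maxval F f K t)%E]).
  by apply: measurable_lee => //; apply: measurable_maxval => //; exact: closedT.
rewrite setTI; apply/seteqP; split=> t /=.
  move=> [v [[Fv vmax] Kv]]; apply: (@le_trans _ _ (f v)%:E).
    by apply: ge_ereal_sup => _ [w [Fw _] <-]; rewrite lee_fin vmax.
  by apply: ereal_sup_ubound; exists v.
have [|u [Fu _ uE]] := maxval_attained (t := t) mF fc closedT.
  by rewrite setIT.
rewrite uE => uK; have FK0 : F t `&` K !=set0.
  apply/set0P/negP => /eqP FK0; move: uK.
  by rewrite /maxval FK0 image_set0 ereal_sup0 leeNy_eq.
have [v [Fv Kv vE]] := maxval_attained mF fc Kc FK0.
exists v; split=> //; split=> // w Fw; move: uK; rewrite vE lee_fin.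
apply: le_trans; rewrite -lee_fin -uE.
by apply: ereal_sup_ubound; exists w.
Qed.

End MaximizersOfFamily.

(** Maximizing the coordinates one after the other shrinks each member of the
    family to a single point, the lexicographically largest one when the last
    coordinate is compared first. *)
Lemma measurable_selection (disp : measure_display) (T : measurableType disp)
    (R : realType) (d : nat) (F : T -> set 'rV[R]_d) :
  measurable_compact_family F ->
  exists s : T -> 'rV[R]_d, (forall t, F t (s t)) /\
    measurable_fun setT (s : T -> borelRd R d).
Proof.
move=> mF.
pose coord (i : 'I_d) (v : 'rV[R]_d) : R := v ord0 i.
pose G (l : seq 'I_d) (t : T) : set 'rV[R]_d :=
  foldr (fun i A => argmax (coord i) A) (F t) l.
have mG l : measurable_compact_family (G l).
  elim: l => [//|i l mGl].
  apply: measurable_compact_family_argmax => //; last exact: coord_continuous.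
have GF l t : G l t `<=` F t.
  by elim: l => [//|i l GlF] v [/GlF].
have Geq l t v w i : G l t v -> G l t w -> i \in l -> v ord0 i = w ord0 i.
  elim: l => [//|j l Gleq] [Gv vmax] [Gw wmax]; rewrite inE => /predU1P[->|il].
    by apply/eqP; rewrite eq_le (vmax _ Gw) (wmax _ Gv).
  exact: Gleq.
have [G0 _ GK] := mG (enum 'I_d).
pose s t := xget 0 (G (enum 'I_d) t).
have sG t : G (enum 'I_d) t (s t).
  by have [v Gv] := G0 t; exact: xgetPex (ex_intro _ v Gv).
have Gs t v : G (enum 'I_d) t v -> v = s t.
  move=> Gv; apply/matrixP => i j; rewrite (ord1 i).
  by apply: Geq Gv (sG t) _; rewrite mem_enum.
exists s; split=> [t|]; first exact: GF (sG t).
apply: (@measurability _ _ T (borelRd R d) setT s (@open 'rV[R]_d)) => //.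
move=> _ [U Uo <-].
rewrite setTI -[X in measurable X]setCK; apply: measurableC.
rewrite (_ : ~` _ = [set t | G (enum 'I_d) t `&` ~` U !=set0]).
  by apply: GK; exact: open_closedC.
apply/seteqP; split=> t /=; first by exists (s t); split.
by move=> [v [/Gs -> ]].
Qed.

(** * Tail comparison and the uniform law *)

Lemma continuous_measurable_borelRd (R : realType) (d : nat)
    (f : 'rV[R]_d -> R) :
  continuous f -> measurable_fun setT (f : borelRd R d -> R).
Proof.
move=> /continuousP fc.
apply: (measurability _ (RGenOpens.measurableE R)) => _ [_ [a [b ->]] <-].
by rewrite setTI; apply: sub_sigma_algebra; apply: fc; exact: interval_open.
Qed.

(** By the tail formula, the expectation of a nonnegative function is monotone
    in its tail probabilities. *)
Lemma le_integral_tail (disp : measure_display) (T : measurableType disp)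
    (R : realType) (P Q : probability T R) (f : T -> R) :
  measurable_fun setT f -> (forall x, 0 <= f x) ->
  (forall t, (P [set x | (t < f x)%R] <= Q [set x | (t < f x)%R])%E) ->
  (\int[P]_x (f x)%:E <= \int[Q]_x (f x)%:E)%E.
Proof.
move=> mf f0 PQ.
pose X : {mfun T >-> R} := mfun_Sub (mem_set mf).
have tail (S : probability T R) t : ccdf (X : {RV S >-> R}) t
    = S [set x | (t < f x)%R].
  rewrite /ccdf /distribution /pushforward; congr (S _).
  by apply/seteqP; split=> x /=; rewrite in_itv/= andbT.
have E (S : probability T R) : (\int[S]_x (f x)%:E =
    \int[lebesgue_measure]_(r in `[0%R, +oo[) ccdf (X : {RV S >-> R}) r)%E.
  by rewrite -ge0_expectation_ccdf// unlock.
rewrite !E; apply: ge0_le_integral => //.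
- by apply: measurable_funTS; exact: ccdf_measurable.
- by apply: measurable_funTS; exact: ccdf_measurable.
- by move=> r _; rewrite !tail.
Qed.

Lemma lebesgue_measure_itvoc0 (R : realType) (a : R) :
  0 <= a -> lebesgue_measure (`]0, a]%classic : set R) = a%:E.
Proof.
move=> a0; rewrite lebesgue_measure_itv/= lte_fin sube0.
by case: ltP => // a0'; congr EFin; apply/eqP; rewrite eq_le a0 a0'.
Qed.

Section UniformLaw.
Context {R : realType}.

Let U : probability (measurableTypeR R) R := uniform_prob (@ltr01 R).

(** The level 0 is dropped because the cut at level 0 need not be compact:
    nothing is known of a selection there. *)
Lemma integral_uniform01 (f : measurableTypeR R -> \bar R) :
  measurable_fun setT f -> (forall x, 0 <= f x)%E ->
  (\int[U]_x f x = \int[lebesgue_measure]_(x in `]0%R, 1%R]) f x)%E.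
Proof.
move=> mf f0; rewrite integral_uniform// subr0 invr1 mul1e.
by rewrite integral_itv_obnd_cbnd//; exact: measurable_funTS.
Qed.

Lemma uniform01E (A : set (measurableTypeR R)) : measurable A ->
  U A = lebesgue_measure (A `&` `]0, 1]).
Proof.
move=> mA; rewrite -(setIT A) -integral_indic// integral_uniform01//.
- by rewrite integral_indic// setIT.
- exact/measurable_EFinP/measurable_indic.
Qed.

End UniformLaw.

(** * The law of a selection at a uniform level *)

Section LevelSelection.
Context {R : realType} {d : nat}.
Context (pi_x : 'rV[R]_d -> R) (m : {mfun measurableTypeR R >-> borelRd R d}).
Context (pi01 : forall v, 0 <= pi_x v <= 1).
Context (pi_m : forall alpha, 0 < alpha <= 1 -> pi_x (m alpha) = alpha).

(** The law of [m alpha] when [alpha] is uniform on [0, 1]. *)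
Definition selection_law : probability (borelRd R d) R :=
  distribution (uniform_prob (@ltr01 R)) m.

Let measurable_preim (B : set (borelRd R d)) : measurable B ->
  measurable (m @^-1` B : set (measurableTypeR R)).
Proof.
by move=> mB; rewrite -[X in measurable X]setTI; exact: measurable_funPT.
Qed.

Lemma selection_lawE (B : set (borelRd R d)) : measurable B ->
  selection_law B = lebesgue_measure (m @^-1` B `&` `]0, 1]).
Proof. by move=> mB; rewrite -uniform01E//; exact: measurable_preim. Qed.

Let measurable_level (B : set (borelRd R d)) : measurable B ->
  measurable (m @^-1` B `&` `]0, 1] : set (measurableTypeR R)).
Proof. by move=> mB; apply: measurableI => //; exact: measurable_preim. Qed.

Lemma pi_le_possibility (B : set 'rV[R]_d) v : B v ->
  pi_x v <= possibility pi_x B.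
Proof.
move=> Bv; apply: ub_le_sup; last by exists v.
by exists 1 => _ [w _ <-]; case/andP: (pi01 w).
Qed.

Lemma possibility_ge0 (B : set 'rV[R]_d) : 0 <= possibility pi_x B.
Proof.
have [->|/set0P[v Bv]] := eqVneq B set0.
  by rewrite /possibility image_set0 sup0.
by apply: le_trans (pi_le_possibility Bv); case/andP: (pi01 v).
Qed.

Lemma selection_law_credal : credal pi_x selection_law.
Proof.
move=> B mB; rewrite selection_lawE//.
rewrite -(lebesgue_measure_itvoc0 (possibility_ge0 B)).
apply: le_measure; rewrite ?inE//; first exact: measurable_level.
move=> a [/= Bm]; rewrite !in_itv/= => a01; have /andP[-> _] := a01.
by rewrite -[X in X <= _](pi_m a01); exact: pi_le_possibility.
Qed.

Lemma measurable_upper_cut a : continuous pi_x ->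
  measurable (upper_cut pi_x a : set (borelRd R d)).
Proof.
move=> pic; rewrite -[X in measurable X]setCK; apply: measurableC.
apply: sub_sigma_algebra; apply: closed_openC.
exact: closed_superlevel.
Qed.

Lemma selection_law_saturating :
  continuous pi_x -> saturating pi_x selection_law.
Proof.
move=> pic; split; first exact: selection_law_credal.
move=> a /andP[a0 a1]; rewrite selection_lawE; last exact: measurable_upper_cut.
(* At level 0 the cut is the whole space. *)
have [->|aN0] := eqVneq a 0.
  rewrite (_ : _ `&` _ = `]0, 1]%classic).
    by rewrite lebesgue_measure_itvoc0 ?subr0.
  by apply/setIidPr => b _; have /andP[] := pi01 (m b).
have {}a0 : 0 < a by rewrite lt_neqAle eq_sym aN0.
rewrite (_ : _ `&` _ = `[a, 1]%classic).
  rewrite lebesgue_measure_itv/= lte_fin; case: ltP => // a1'.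
  by congr EFin; apply/eqP; rewrite eq_sym subr_eq0 eq_le a1 a1'.
apply/seteqP; split=> b /=; rewrite !in_itv/=.
  by move=> [+ b01]; rewrite /upper_cut/= pi_m// => ->; case/andP: b01.
move=> /andP[ab b1]; have b01 : 0 < b <= 1 by rewrite (lt_le_trans a0).
by rewrite /upper_cut/= pi_m.
Qed.

(** If [m alpha] maximizes [f] over the cut at each level, then [m alpha] lies
    in the event [f > t] at every level below the possibility of that event. *)
Lemma credal_tail_le (P : probability (borelRd R d) R) (f : 'rV[R]_d -> R) t :
  credal pi_x P -> continuous f ->
  (forall alpha, 0 < alpha <= 1 -> argmax f (upper_cut pi_x alpha) (m alpha)) ->
  (P [set v | (t < f v)%R] <= selection_law [set v | (t < f v)%R])%E.
Proof.
move=> PC fc mmax; set B := [set v | _].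
have mB : measurable (B : set (borelRd R d)).
  apply: sub_sigma_algebra.
  by apply: (@open_comp _ _ f _ _ (@open_gt _ t)) => v _; exact: fc.
apply: (le_trans (PC _ mB)); rewrite selection_lawE//.
apply: (@le_trans _ _ (lebesgue_measure `]0, possibility pi_x B[)).
  rewrite lebesgue_measure_itv/= lte_fin sube0.
  by case: ltP => //; rewrite lee_fin.
apply: le_measure; rewrite ?inE//; first exact: measurable_level.
move=> a /=; rewrite in_itv/= => /andP[a0 aB].
have piB0 : pi_x @` B !=set0.
  apply/set0P/negP => /eqP piB0; move: aB.
  by rewrite /possibility piB0 sup0 ltNge ltW.
have [_ [v Bv <-] av] := sup_gt piB0 aB.
have a01 : 0 < a <= 1.
  by rewrite a0 (le_trans (ltW av))//; case/andP: (pi01 v).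
split; last by rewrite in_itv.
by apply: (lt_le_trans Bv); apply: (mmax _ a01).2; exact: ltW.
Qed.

Lemma expect_le_selection_law (P : probability (borelRd R d) R)
    (f : 'rV[R]_d -> R) :
  credal pi_x P -> continuous f -> (forall v, 0 <= f v) ->
  (forall alpha, 0 < alpha <= 1 -> argmax f (upper_cut pi_x alpha) (m alpha)) ->
  (expect P f <= expect selection_law f)%E.
Proof.
move=> PC fc f0 mmax; apply: le_integral_tail => //.
  exact: continuous_measurable_borelRd.
by move=> t; exact: credal_tail_le.
Qed.

Lemma expect_selection_law (f : 'rV[R]_d -> R) :
  continuous f -> (forall v, 0 <= f v) ->
  (forall alpha, 0 < alpha <= 1 -> argmax f (upper_cut pi_x alpha) (m alpha)) ->
  expect selection_law f = choquet_loss f pi_x.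
Proof.
move=> fc f0 mmax; rewrite /expect /selection_law.
have mf := continuous_measurable_borelRd fc.
rewrite ge0_integral_distribution//; last exact/measurable_EFinP.
rewrite integral_uniform01; last 2 first.
- apply: measurableT_comp => //; exact/measurable_EFinP.
- by move=> a; rewrite lee_fin.
have fE a : `]0, 1]%classic a -> ((f (m a))%:E =
    ereal_sup [set (f v)%:E | v in upper_cut pi_x a])%E.
  rewrite /= in_itv/= => a01; have [cm fmax] := mmax _ a01.
  apply/eqP; rewrite eq_le; apply/andP; split.
    by apply: ereal_sup_ubound; exists (m a).
  by apply: ge_ereal_sup => _ [w cw <-]; rewrite lee_fin fmax.
rewrite /choquet_loss -integral_itv_obnd_cbnd.
  by apply: eq_integral => a; rewrite inE => /fE.
apply: (eq_measurable_fun (fun a => (f (m a))%:E)).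
  by move=> a; rewrite inE => /fE.
apply: measurable_funTS; apply/measurable_EFinP.
exact: measurableT_comp.
Qed.

End LevelSelection.

(** * Selecting maximizers over the cuts of a contour *)

Section Cuts.
Context {R : realType} {d : nat}.
Context (pi_x : 'rV[R]_d -> R) (thetahat : 'rV[R]_d).
Context (pi_contour : is_contour pi_x).
Context (pi_continuous : continuous pi_x).
Context (pi_mode : unimodal_at pi_x thetahat).
Context (pi_vanishes : vanishes_at_infinity pi_x).

Lemma contour_mode : pi_x thetahat = 1.
Proof.
have [_ pimax] : argmax pi_x setT thetahat by rewrite pi_mode.
apply/eqP; rewrite -pi_contour.2 eq_le; apply/andP; split.
  apply: ub_le_sup; last by exists thetahat.
  by exists (pi_x thetahat) => _ [v _ <-]; exact: pimax.
apply: ge_sup; first by exists (pi_x thetahat), thetahat.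
by move=> _ [v _ <-]; exact: pimax.
Qed.

Lemma upper_cut_mode a : a <= 1 -> upper_cut pi_x a thetahat.
Proof. by rewrite -contour_mode. Qed.

(* The cut at level [a] for [a] in ]0, 1]. At the other levels the singleton of
   [thetahat], which belongs to all these cuts, keeps the set compact. *)
Let cut (a : measurableTypeR R) : set 'rV[R]_d :=
  if 0 < a <= 1 then upper_cut pi_x a else [set thetahat].

Let measurable_compact_family_cut : measurable_compact_family cut.
Proof.
have cut_mode a : cut a thetahat.
  by rewrite /cut; case: ifPn => // /andP[_]; exact: upper_cut_mode.
split=> [a|a|K Kc]; first by exists thetahat.
  rewrite /cut; case: ifPn => [/andP[a0 _]|_]; last exact: compact_set1.
  exact: upper_cut_compact.
have [Km|KNm] := pselect (K thetahat).
  rewrite (_ : [set t | _] = setT)//.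
  by apply/seteqP; split=> // a _; exists thetahat.
(* When K misses thetahat, only levels in ]0, 1] count; as the cuts are nested,
   those at which K is met form an interval. *)
apply: is_interval_measurable => a b; rewrite /= /cut.
case: ifPn => [/andP[a0 _] _|_ [_ [-> /KNm]]//].
case: ifPn => [/andP[_ b1] [v [bv Kv]]|_ [_ [-> /KNm]]//].
move=> c /andP[ac cb]; rewrite (lt_le_trans a0 ac) (le_trans cb b1)/=.
by exists v; split=> //; exact: le_trans bv.
Qed.

Lemma measurable_argmax_selection (f : 'rV[R]_d -> R) : continuous f ->
  exists m : {mfun measurableTypeR R >-> borelRd R d},
    forall a, 0 < a <= 1 -> argmax f (upper_cut pi_x a) (m a).
Proof.
move=> fc.
have [|s [sargmax ms]] :=
  @measurable_selection _ _ _ _ (fun a => argmax f (cut a)).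
  exact: measurable_compact_family_argmax.
exists (mfun_Sub (mem_set ms)) => a a01.
by have := sargmax a; rewrite /cut a01.
Qed.

End Cuts.

Theorem proposition3p1 (R : realType) (d : nat) (pi_x : 'rV[R]_d -> R)
    (thetahat theta : 'rV[R]_d) (g : R -> R) :
  (0 < d)%N ->
  is_contour pi_x ->
  continuous pi_x ->
  unimodal_at pi_x thetahat ->
  vanishes_at_infinity pi_x ->
  (forall r : R, 0 <= r -> 0 <= g r) ->
  {within [set r : R | 0 <= r], continuous g} ->
  (forall r s : R, 0 <= r -> r < s -> g r < g s) ->
  (choquet_loss (radial_loss g theta) pi_x < +oo)%E ->
  [/\ (forall alpha : R, 0 < alpha < 1 ->
         argmax (radial_loss g theta) (upper_cut pi_x alpha) !=set0 /\
         argmax (radial_loss g theta) (upper_cut pi_x alpha)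
           `<=` [set v | pi_x v = alpha]),
      (exists Q : probability (borelRd R d) R,
         saturating pi_x Q /\
         expect Q (radial_loss g theta) = choquet_loss (radial_loss g theta) pi_x)
    & ereal_sup [set expect Q (radial_loss g theta) | Q in credal pi_x]
        = ereal_sup [set expect Q (radial_loss g theta) | Q in saturating pi_x] /\
      ereal_sup [set expect Q (radial_loss g theta) | Q in saturating pi_x]
        = choquet_loss (radial_loss g theta) pi_x].
Proof.
move=> d0 picont pic pimode pi0 g0 gc gi _.
set Gamma := radial_loss g theta.
have Gc : continuous Gamma by exact: continuous_radial_loss.
have G0 v : 0 <= Gamma v by apply: g0; exact: enorm_ge0.
have pi01 := picont.1.
have Glevel alpha := @argmax_radial_loss_level _ _ pi_x g theta alpha d0 pic gi.
have [m mmax] := measurable_argmax_selection picont pic pimode pi0 Gc.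
have pim alpha : 0 < alpha <= 1 -> pi_x (m alpha) = alpha.
  by move=> /mmax /Glevel.
have Qsat := selection_law_saturating pi01 pim pic.
have QE := expect_selection_law Gc G0 mmax.
have supC : ereal_sup [set expect P Gamma | P in credal pi_x]
    = choquet_loss Gamma pi_x.
  apply/eqP; rewrite eq_le; apply/andP; split.
    apply: ge_ereal_sup => _ [P PC <-]; rewrite -QE.
    exact: (expect_le_selection_law pi01).
  rewrite -QE; apply: ereal_sup_ubound.
  by exists (selection_law m) => //; exact: Qsat.1.
have supS : ereal_sup [set expect P Gamma | P in saturating pi_x]
    = choquet_loss Gamma pi_x.
  apply/eqP; rewrite eq_le; apply/andP; split.
    by rewrite -supC; apply: ereal_sup_le => _ [P [PC _] <-]; exists P.
  by rewrite -QE; apply: ereal_sup_ubound; exists (selection_law m).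
split.
- move=> alpha /andP[alpha0 alpha1]; split; last exact: Glevel.
  by exists (m alpha); apply: mmax; rewrite alpha0 ltW.
- by exists (selection_law m).
- by rewrite supC supS.
Qed.
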